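(* Let $G=\{g_n:n\in\omega\}$ be a countable group with identity $e$ and let $\varphi$ be a filter on $G$. Then $\varphi$ is a $PT$-filter if and only if for each $g\in G\setminus\{e\}$ there exists a sequence $\{C_n\}_{n\in\omega}$ of elements of $\varphi^{*}$ such that $$g\notin f(C_{i_0+j_0},C_{i_1+j_1},\ldots,C_{i_n+j_n})$$ for each $n\in\omega$ and each group word $f(x_{i_0j_0},\ldots,x_{i_nj_n})\in\mathcal{X}_n$.
   Context: $G$ is not assumed Abelian. A paratopological group topology on $G$ is a topology making multiplication jointly continuous. A filter $\varphi$ converges to $e$ if every neighborhood of $e$ belongs to $\varphi$. $\varphi$ is a $PT$-filter if there is a $T_1$ paratopological group topology on $G$ in which $\varphi$ converges to $e$. Put $U^{*}=U\cup\{e\}$ and $\varphi^{*}=\{U^{*}:U\in\varphi\}$. Let $\{x_{ij}:i,j\in\omega\}$ be a set of variables. For $n\in\omega$, $\mathcal{X}_n$ is the finite set of group words $$f(x_{i_0j_0},\ldots,x_{i_nj_n})=g_{j_0}^{-1}x_{i_0j_0}g_{j_0}\,g_{j_1}^{-1}x_{i_1j_1}g_{j_1}\cdots g_{j_n}^{-1}x_{i_nj_n}g_{j_n}$$ with $i_k,j_k\in\omega$, $i_k+j_k\le n$ for all $0\le k\le n$, and $i_0,\ldots,i_n$ distinct. For subsets of $G$, $f(C_{i_0+j_0},\ldots,C_{i_n+j_n})$ is the set product $g_{j_0}^{-1}C_{i_0+j_0}g_{j_0}\cdots g_{j_n}^{-1}C_{i_n+j_n}g_{j_n}$, obtained by substituting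 $C_{i_k+j_k}$ for $x_{i_kj_k}$. *)

(* Defs.v *)
From HB Require Import structures.
From mathcomp Require Import all_boot all_order all_algebra.
From mathcomp Require Import all_classical all_reals all_analysis.

Set Implicit Arguments.
Unset Strict Implicit.
Unset Printing Implicit Defensive.

Local Open Scope classical_set_scope.

(* The topology is not canonical on the group G but is quantified over, so it
   is represented by a class [tau] of the library's [Topological] structure on
   the carrier of G. *)
Definition topologized (G : groupType) (tau : Topological.axioms_ G) :
  topologicalType := Topological.Pack tau.

Definition paratopological (G : groupType) (tau : Topological.axioms_ G) :=
  continuous (fun p : topologized tau * topologized tau =>
    ((p.1 : G) * (p.2 : G))%g : topologized tau).

Definition PT_filter (G : groupType) (phi : set_system G) :=
  exists tau : Topological.axioms_ G,
    [/\ paratopological tau,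
        accessible_space (topologized tau)
      & phi --> (1%g : topologized tau)].

Definition star (G : groupType) (U : set G) : set G := U `|` [set 1%g].

Definition star_system (G : groupType) (phi : set_system G) : set_system G :=
  [set star U | U in phi].

(* Group words with coefficients in G and variables x_ij are sequences of
   letters; only positive powers of the variables are needed. *)
Inductive letter (G : Type) :=
  | Coef of G
  | Var of nat & nat.
Arguments Var {G}.

Definition conj_factor (G : groupType) (g : nat -> G) (ij : nat * nat) :
    seq (letter G) :=
  [:: Coef (g ij.2)^-1%g; Var ij.1 ij.2; Coef (g ij.2)].

(* The index sequence p is (i_0, j_0), ..., (i_n, j_n). *)
Definition words (G : groupType) (g : nat -> G) (n : nat) :
    set (seq (letter G)) :=
  [set flatten [seq conj_factor g ij | ij <- p] | p in
    [set p : seq (nat * nat) |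
      [/\ size p = n.+1,
          {in p, forall ij, ij.1 + ij.2 <= n}
        & uniq [seq ij.1 | ij <- p]]]].

Definition set_mulg (G : groupType) (A B : set G) : set G :=
  [set (a * b)%g | a in A & b in B].

Definition subst_letter (G : groupType) (S : nat -> nat -> set G)
    (l : letter G) : set G :=
  match l with
  | Coef a => [set a]
  | Var i j => S i j
  end.

Definition subst_word (G : groupType) (S : nat -> nat -> set G)
    (f : seq (letter G)) : set G :=
  \big[@set_mulg G / [set 1%g]]_(l <- f) subst_letter S l.

(* Main.v *)
(* For a sequence [C] in [star_system phi], let [word_nbhs g C] be the set of all
   products of conjugates [C (i + j) ^ g j] over finite sequences of pairs (i, j)
   with distinct [i]. Such sets form a base at 1 of a paratopological group
   topology to which phi converges: splitting the indices [i] into even and odd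
   ones gives continuity of the product at 1, and the [g j] ranging over all of G
   gives invariance under conjugation. The condition on words says that every
   a <> 1 is missed by some [word_nbhs g C], which is the T1 axiom. Conversely,
   given a T1 topology and a neighbourhood U of 1 missing a, choose neighbourhoods
   [V 0 = U], [V k.+1 V k.+1 V k.+1] inside [V k], and [C] with
   [C (i + j) ^ g j] inside [V i.+1]; then every word takes its values in U. *)
Require Import Defs.
From HB Require Import structures.
From mathcomp Require Import all_boot all_order all_algebra.
From mathcomp Require Import all_classical all_reals all_analysis.

Set Implicit Arguments.
Unset Strict Implicit.
Unset Printing Implicit Defensive.

Local Open Scope classical_set_scope.

(** * Products of sets and values of words *)

Lemma mem_set_mulg (G : groupType) (A B : set G) x y :
  A x -> B y -> set_mulg A B (x * y)%g.
Proof. by move=> Ax By; exists x => //; exists y. Qed.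

Lemma set_mulgA (G : groupType) : associative (@set_mulg G).
Proof.
move=> A B C; apply/seteqP; split=> x.
  case=> a Aa [_ [b Bb [c Cc <-]] <-]; rewrite mulgA.
  by do 2?apply: mem_set_mulg.
case=> _ [a Aa [b Bb <-]] [c Cc <-]; rewrite -mulgA.
by do 2?apply: mem_set_mulg.
Qed.

Lemma set_mul1g (G : groupType) : left_id [set 1%g] (@set_mulg G).
Proof.
move=> A; apply/seteqP; split=> [x [_ -> [a Aa <-]]|x Ax]; first by rewrite mul1g.
by rewrite -[x]mul1g; apply: mem_set_mulg.
Qed.

Lemma set_mulg1 (G : groupType) : right_id [set 1%g] (@set_mulg G).
Proof.
move=> A; apply/seteqP; split=> [x [a Aa [_ -> <-]]|x Ax]; first by rewrite mulg1.
by rewrite -[x]mulg1; apply: mem_set_mulg.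
Qed.

HB.instance Definition _ (G : groupType) :=
  Monoid.isLaw.Build (set G) [set 1%g] (@set_mulg G)
    (@set_mulgA G) (@set_mul1g G) (@set_mulg1 G).

(** The value of the word indexed by [p], each three-letter factor merged into one conjugate. Any
    sequence [p] is allowed, so that words can be cut and extended. *)
Definition conj_prod (G : groupType) (g : nat -> G) (C : nat -> set G)
    (p : seq (nat * nat)) : set G :=
  \big[@set_mulg G / [set 1%g]]_(ij <- p)
    [set (x ^ g ij.2)%g | x in C (ij.1 + ij.2)].

Lemma subst_wordE (G : groupType) (g : nat -> G) (C : nat -> set G)
    (p : seq (nat * nat)) :
  subst_word (fun i j => C (i + j)%N) (flatten [seq conj_factor g ij | ij <- p])
  = conj_prod g C p.
Proof.
rewrite /subst_word /conj_prod; elim: p => [|ij p IHp]; first by rewrite !big_nil.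
rewrite [flatten _]/= big_cons 3!big_cons IHp /= !set_mulgA; congr set_mulg.
apply/seteqP; split=> x.
  by case=> _ [_ -> [c Cc <-]] [_ -> <-]; exists c => //; rewrite conjgE mulgA.
case=> c Cc <-; rewrite conjgE mulgA.
by do 2?apply: mem_set_mulg.
Qed.

(** * Sets of word values as neighbourhoods of 1 *)

Definition word_nbhs (G : groupType) (g : nat -> G) (C : nat -> set G) : set G :=
  \bigcup_(p in [set p | uniq [seq ij.1 | ij <- p]]) conj_prod g C p.

Lemma conj_prod_pad (G : groupType) (g : nat -> G) (C : nat -> set G)
    (p q : seq (nat * nat)) :
  (forall n, C n 1%g) -> conj_prod g C p `<=` conj_prod g C (p ++ q).
Proof.
move=> C1 x px; rewrite /conj_prod big_cat -[x]mulg1; apply: mem_set_mulg => //.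
elim: q => [|ij q IHq]; first by rewrite big_nil.
rewrite big_cons; exists 1%g; first by exists 1%g; rewrite ?conj1g.
by exists 1%g; rewrite ?mulg1.
Qed.

(* Inserting pairs (i, 0) for the missing [i <= n], with [n] bounding all [i + j],
   turns an arbitrary sequence with distinct [i] into one indexing a word. *)
Lemma word_nbhs_words (G : groupType) (g : nat -> G) (C : nat -> set G) (x : G) :
  (forall n, C n 1%g) -> word_nbhs g C x ->
  exists n f, words g n f /\ subst_word (fun i j => C (i + j)%N) f x.
Proof.
move=> C1 [p /= uniqp px].
pose n := \max_(ij <- p) (ij.1 + ij.2).
have len ij : ij \in p -> ij.1 + ij.2 <= n.
  by move=> pij; apply: (@leq_bigmax_seq _ _ xpredT (fun ij => ij.1 + ij.2)).
pose s := [seq i <- iota 0 n.+1 | i \notin [seq ij.1 | ij <- p]].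
pose q := p ++ [seq (i, 0) | i <- s].
have qE : [seq ij.1 | ij <- q] = [seq ij.1 | ij <- p] ++ s.
  by rewrite map_cat -map_comp map_id.
have uniqq : uniq [seq ij.1 | ij <- q].
  rewrite qE cat_uniq uniqp filter_uniq ?iota_uniq // andbT /=.
  by apply/hasPn=> i; rewrite mem_filter => /andP[].
exists n, (flatten [seq conj_factor g ij | ij <- q]); split; last first.
  by rewrite subst_wordE; apply: conj_prod_pad.
exists q => //; split=> //.
  (* The first indices in [q] are exactly 0, ..., n, each occurring once. *)
  rewrite -(size_map fst) -[RHS](size_iota 0); apply: perm_size.
  apply: uniq_perm => // [|i]; first exact: iota_uniq.
  rewrite qE mem_cat mem_filter mem_iota; case: (boolP (i \in map fst p)) => //.
  by case/mapP=> ij /len ijn ->; rewrite add0n ltnS (leq_trans (leq_addr _ _) ijn).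
move=> ij; rewrite mem_cat => /orP[/len //|/mapP[i]].
by rewrite mem_filter mem_iota add0n ltnS => /andP[_ /andP[_ ?]] -> /=; rewrite addn0.
Qed.

(** Conjugation by [h] acts factor by factor and turns x ^ g j into x ^ (g j h). The case h = 1
    serves to renumber first indices or to enlarge the sets. *)
Lemma conj_prod_reindex (G : groupType) (g : nat -> G) (C D : nat -> set G)
    (h : G) (t : nat * nat -> nat * nat) (p : seq (nat * nat)) (x : G) :
  (forall ij, (g ij.2 * h)%g = g (t ij).2) ->
  (forall ij, D (ij.1 + ij.2) `<=` C ((t ij).1 + (t ij).2)) ->
  conj_prod g D p x -> conj_prod g C [seq t ij | ij <- p] (x ^ h)%g.
Proof.
move=> gt DC; rewrite /conj_prod big_map; elim: p x => [|ij p IHp] x.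
  by rewrite !big_nil => ->; rewrite /= conj1g.
rewrite !big_cons => -[_ [d Dd <-] [y py <-]]; rewrite conjMg.
apply: mem_set_mulg; last exact: IHp.
by exists d; [apply: DC|rewrite -gt conjgM].
Qed.

Lemma star_systemP (G : groupType) (phi : set_system G) (A : set G) :
  Filter phi -> star_system phi A <-> phi A /\ A 1%g.
Proof.
move=> F; split=> [[U phiU <-]|[phiA A1]].
  by split; [apply: filterS phiU => x; left|right].
by exists A => //; apply/seteqP; split=> [x [|->]|x]; [| |left].
Qed.

(** [C] need not be decreasing; these finite intersections put the n-th set inside every [C k] that
    a renumbering may call for. *)
Definition initial_cap (G : Type) (C : nat -> set G) (b : nat -> nat) (n : nat) :
    set G := [set x | forall k : 'I_(b n).+1, C k x].

Lemma initial_cap_sub (G : Type) (C : nat -> set G) (b : nat -> nat) n k :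
  k <= b n -> initial_cap C b n `<=` C k.
Proof. by rewrite -ltnS => kb x /(_ (Ordinal kb)). Qed.

Lemma star_initial_cap (G : groupType) (phi : set_system G) (C : nat -> set G)
    (b : nat -> nat) n :
  Filter phi -> (forall n, star_system phi (C n)) ->
  star_system phi (initial_cap C b n).
Proof.
move=> F Cphi; apply/star_systemP; split=> [|k]; last first.
  by have /star_systemP[] := Cphi k.
by apply: filter_forall => k; have /star_systemP[] := Cphi k.
Qed.

(* Even and odd first indices keep the letters of the two factors apart. *)
Lemma word_nbhsM (G : groupType) (g : nat -> G) (C : nat -> set G) :
  set_mulg (word_nbhs g (initial_cap C (fun n => n.*2.+1)))
           (word_nbhs g (initial_cap C (fun n => n.*2.+1)))
  `<=` word_nbhs g C.
Proof.
move=> _ [x [p /= up px] [y [q /= uq qy] <-]].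
(* Since b + 2i + j is at most 2(i + j) + 1, intersecting up to [n.*2.+1] covers every renumbered
   pair. *)
pose t (b : bool) (ij : nat * nat) := (b + ij.1.*2, ij.2).
exists (map (t false) p ++ map (t true) q) => /=.
  rewrite map_cat -!map_comp cat_uniq; apply/and3P; split.
  - rewrite (map_comp (fun i => i.*2) fst) map_inj_uniq //; exact: double_inj.
  - apply/hasPn=> _ /mapP[ij _ ->]; apply/mapP=> -[kl _] /= /(congr1 odd).
    by rewrite !oddD !odd_double.
  - rewrite (map_comp (fun i => i.*2.+1) fst) map_inj_uniq //.
    by move=> i j [] /double_inj.
have tP b z r : conj_prod g (initial_cap C (fun n => n.*2.+1)) r z ->
    conj_prod g C (map (t b) r) z.
  rewrite -{2}[z]conjg1; apply: conj_prod_reindex => ij; first by rewrite mulg1.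
  apply: initial_cap_sub; rewrite /t /= -add1n doubleD addnA.
  by apply: leq_add; [rewrite leq_add2r leq_b1|rewrite -addnn leq_addr].
rewrite /conj_prod big_cat; apply: mem_set_mulg; exact: tP.
Qed.

(* Right multiplication by [h] permutes the coefficients, [g_j h = g_(pi j)]. *)
Lemma word_nbhsJ (G : groupType) (g : nat -> G) (C : nat -> set G) (h : G) :
  range g = [set: G] ->
  exists b, forall x, word_nbhs g (initial_cap C b) x -> word_nbhs g C (x ^ h)%g.
Proof.
move=> gT.
have /choice[pi piP] j : exists k, (g j * h)%g = g k.
  by have : range g (g j * h)%g by [rewrite gT]; case=> k _ <-; exists k.
(* A set sees only m = i + j, so the bound must serve i + pi j for every j up to m. *)
exists (fun m => m + \max_(j < m.+1) pi j) => x [p /= up px].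
exists [seq (ij.1, pi ij.2) | ij <- p] => /=; first by rewrite -map_comp.
apply: conj_prod_reindex px => ij //; apply: initial_cap_sub => /=.
apply: leq_add; first exact: leq_addr.
have jm : ij.2 < (ij.1 + ij.2).+1 by rewrite ltnS leq_addl.
exact: (@leq_bigmax _ (fun j : 'I__ => pi j) (Ordinal jm)).
Qed.

Definition word_filter (G : groupType) (g : nat -> G) (phi : set_system G) :
    set_system G :=
  [set A | exists2 C, forall n, star_system phi (C n) & word_nbhs g C `<=` A].

Lemma word_nbhs1 (G : groupType) (g : nat -> G) (C : nat -> set G) :
  word_nbhs g C 1%g.
Proof. by exists [::]; rewrite // /conj_prod big_nil. Qed.

Lemma word_filter_filter (G : groupType) (g : nat -> G) (phi : set_system G) :
  Filter phi -> Filter (word_filter g phi).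
Proof.
move=> F; split=> [|A B [C Cphi CA] [D Dphi DB]|A B AB [C Cphi CA]].
- by exists (fun=> setT) => // _; apply/star_systemP; split; [exact: filterT|].
- exists (fun n => C n `&` D n) => [n|x [p up px]].
    have /star_systemP[? ?] := Cphi n; have /star_systemP[? ?] := Dphi n.
    by apply/star_systemP; split; [apply: filterI|].
  by split; [apply: CA|apply: DB]; exists p => //;
    rewrite -[p]map_id -[x]conjg1; apply: conj_prod_reindex px => ij;
    rewrite ?mulg1 // => y [].
- by exists C => //; apply: subset_trans AB.
Qed.

(** * The topology of a filter at the identity *)

(** The condition on [set_mulg V V] makes a neighbourhood of a point one of all nearby points and
    gives continuity at (1, 1); conjugation carries continuity to other pairs, as only left
    translates are used. *)
Lemma paratopology_of_filter (G : groupType) (N : set_system G) :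
  Filter N ->
  (forall U, N U -> U 1%g) ->
  (forall U, N U -> exists2 V, N V & set_mulg V V `<=` U) ->
  (forall h U, N U -> N [set x | U (x ^ h)%g]) ->
  exists2 tau : Topological.axioms_ G, paratopological tau &
    forall x A, nbhs (x : topologized tau) A = N [set y | A (x * y)%g].
Proof.
move=> F N1 NM NJ.
pose nb (x : G) : set_system G := [set A | N [set y | A (x * y)%g]].
pose T : nbhsType := HB.pack (G : Type) (Choice.class G) (hasNbhs.Build G nb).
have nb_filter (x : T) : ProperFilter (nbhs x).
  have nbF : Filter (nbhs x).
    split; first exact: (filterT (F := N)).
      by move=> A B; apply: (filterI (F := N)).
    by move=> A B AB; apply: (filterS (F := N)) => y; apply: AB.
  by apply: Build_ProperFilter_ex => A /N1; exists (x * 1 : G)%g.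
have nb1 (x : T) (A : set T) : nbhs x A -> A x.
  by move=> /N1 /=; rewrite mulg1.
have nbnb (x : T) (A : set T) : nbhs x A -> nbhs x (nbhs^~ A).
  move=> /NM[V NV VA]; apply: (filterS (F := N)) (NV) => y Vy.
  apply: (filterS (F := N)) (NV) => z Vz /=.
  by rewrite -mulgA; apply: VA; apply: mem_set_mulg.
pose T' : topologicalType :=
  HB.pack (G : Type) T (Nbhs_isNbhsTopological.Build T nb_filter nb1 nbnb).
exists (Topological.class T') => // -[a b] W /=.
move=> /NM[V NV VW].
(* Writing x = a u and y = b v gives x y = a b (u ^ b) v, so it suffices that u ^ b and v lie in
   [V]. *)
exists ([set x | V ((a^-1 * x) ^ b)%g], [set y | V (b^-1 * y)%g]).
  split=> /=.
    by apply: (filterS (F := N)) (NJ b _ NV) => x /=; rewrite mulKg.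
  by apply: (filterS (F := N)) (NV) => x /=; rewrite mulKg.
move=> [x y] [/= Vx Vy].
have := VW _ (mem_set_mulg Vx Vy).
by rewrite /= conjgE -!mulgA !mulVKg.
Qed.

(** * From a topology to the sets substituted in words *)

(* The letter with first index [k], if it occurs, lies in [V k.+1] and splits the
   word into two words with first indices above [k], so the product of the three
   parts is in [V k.+1 V k.+1 V k.+1], a subset of [V k]. *)
Lemma conj_prod_sub (G : groupType) (g : nat -> G) (C V : nat -> set G)
    (p : seq (nat * nat)) :
  (forall k, V k 1%g) ->
  (forall k, set_mulg (V k.+1) (set_mulg (V k.+1) (V k.+1)) `<=` V k) ->
  (forall i j x, C (i + j) x -> V i.+1 (x ^ g j)%g) ->
  uniq [seq ij.1 | ij <- p] -> conj_prod g C p `<=` V 0.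
Proof.
move=> V1 VM CV up.
have V_nincr k : V k.+1 `<=` V k.
  move=> x Vx; apply: VM; rewrite -[x]mulg1; apply: mem_set_mulg => //.
  by exists 1%g => //; exists 1%g; rewrite ?mulg1.
(* Induction on the width [d] of a window from k to k + d - 1 holding all first indices; at width 0
   the word is empty. *)
suff main d : forall k q, uniq [seq ij.1 | ij <- q] ->
    {in q, forall ij, k <= ij.1 < k + d} -> conj_prod g C q `<=` V k.
  apply: (main (\max_(ij <- p) ij.1).+1) => // ij pij; rewrite add0n ltnS /=.
  exact: (@leq_bigmax_seq _ _ xpredT fst).
elim: d => [|d IHd] k q uq qk.
  case: q qk {uq} => [_ x|ij q /(_ ij)]; first by rewrite /conj_prod big_nil => ->.
  by rewrite mem_head addn0 leqNgt => /(_ isT) /andP[/negbTE->].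
have step r : uniq [seq ij.1 | ij <- r] -> {subset r <= q} ->
    k \notin [seq ij.1 | ij <- r] -> conj_prod g C r `<=` V k.+1.
  move=> ur rq kr; apply: IHd => // ij rij.
  have /andP[kij ijk] := qk _ (rq _ rij).
  rewrite addSnnS ijk andbT ltn_neqAle kij andbT.
  by apply: contra kr => /eqP->; apply: map_f.
case: (boolP (k \in [seq ij.1 | ij <- q])) => [/mapP[[i j] qij /= kE]|]; last first.
  by move=> kq; apply: subset_trans (V_nincr k); apply: step.
subst i; case/splitPr: qij uq step {qk} => q1 q2.
rewrite map_cat /= cat_uniq /= negb_or => /and3P[uq1 /andP[kq1 _] /andP[kq2 uq2]] step.
rewrite /conj_prod big_cat big_cons => x [x1 q1x1 [_ [_ [c Cc <-] [x2 q2x2 <-]] <-]].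
apply: VM; apply: mem_set_mulg; last apply: mem_set_mulg.
- by apply: step q1x1 => // ij q1ij; rewrite mem_cat q1ij.
- exact: CV Cc.
- by apply: step q2x2 => // ij q2ij; rewrite mem_cat inE q2ij !orbT.
Qed.

Lemma paratopological_nbhs (G : groupType) (tau : Topological.axioms_ G)
    (a b : topologized tau) (W : set (topologized tau)) :
  paratopological tau -> nbhs (((a : G) * (b : G))%g : topologized tau) W ->
  exists A B : set (topologized tau),
    [/\ nbhs a A, nbhs b B & set_mulg A B `<=` W].
Proof.
move=> tauM /(tauM (a, b))[[A B] /= [Aa Bb] ABW]; exists A, B; split=> //.
by move=> _ [x Ax [y By <-]]; apply: (ABW (x, y)).
Qed.

Lemma PT_filter_words (G : groupType) (g : nat -> G) (phi : set_system G) (a : G) :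
  Filter phi -> PT_filter phi -> a <> 1%g ->
  exists C : nat -> set G,
    (forall n, star_system phi (C n)) /\
    forall n f, words g n f -> ~ subst_word (fun i j => C (i + j)%N) f a.
Proof.
move=> F [tau [tauM T1 phi1]] a1.
pose e : topologized tau := 1%g.
have [U Ue Ua] : exists2 U : set G, nbhs e U & ~ U a.
  have /T1[U [oU /set_mem eU /set_mem aU]] : e != a :> topologized tau.
    by apply/eqP=> /esym.
  by exists U => //; apply: open_nbhs_nbhs.
(* The hypothesis on [W] stands under the existential so that choice yields a function on all sets,
   which can be iterated from [U]. *)
have cube (W : set G) : exists W' : set G, nbhs e W ->
    nbhs e W' /\ set_mulg W' (set_mulg W' W') `<=` W.
  case: (pselect (nbhs e W)) => [We|nWe]; last by exists W.
  have [|A [B [Ae Be ABW]]] := paratopological_nbhs (a := e) (b := e) (W := W) tauM.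
    by rewrite mulg1.
  have [|A' [B' [Ae' Be' ABB]]] := paratopological_nbhs (a := e) (b := e) (W := B) tauM.
    by rewrite mulg1.
  exists (A `&` (A' `&` B')) => _; split; first by do 2?apply: filterI.
  move=> _ [x [Ax _] [_ [y [_ [A'y _]] [z [_ [_ B'z]] <-]] <-]].
  by apply: ABW; apply: mem_set_mulg => //; apply: ABB; apply: mem_set_mulg.
have /choice[h hP] := cube.
pose V k := iter k h U.
have Ve k : nbhs e (V k) by elim: k => // k /hP[].
have VM k : set_mulg (V k.+1) (set_mulg (V k.+1) (V k.+1)) `<=` V k.
  by have [] := hP _ (Ve k).
(* As x ^ b = b^-1 (x b), continuity is used at (b^-1, b) and then at (1, b). *)
have Vconj (b : G) (W : set G) : nbhs e W -> nbhs e [set x | W (x ^ b)%g].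
  move=> We.
  have [|A [B [Ab Be ABW]]] :=
    paratopological_nbhs (a := b^-1%g) (b := b) (W := W) tauM; first by rewrite mulVg.
  have [|A' [B' [Ae' Bb' ABA]]] :=
    paratopological_nbhs (a := e) (b := b) (W := B) tauM; first by rewrite mul1g.
  apply: filterS Ae' => x A'x /=; rewrite conjgE.
  apply: ABW; apply: mem_set_mulg; first exact: nbhs_singleton Ab.
  by apply: ABA; apply: mem_set_mulg => //; exact: nbhs_singleton Bb'.
(* [C n] must serve every pair with i + j = n; there are finitely many, so the intersection is still
   a neighbourhood of 1. *)
pose C n : set G := [set x | forall i : 'I_n.+1, V i.+1 (x ^ g (n - i)%N)%g].
have Ce n : nbhs e (C n).
  by apply: (filter_forall (F := nbhs e)) => i; apply: Vconj.
exists C; split=> [n|n _ [p [_ _ up] <-]].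
  apply/star_systemP; split; first exact: phi1.
  exact: nbhs_singleton (Ce n).
rewrite subst_wordE => /(conj_prod_sub (V := V)); case/(_ _ _ _ up)/Ua => //.
  by move=> k; apply: nbhs_singleton (Ve k).
move=> i j x Cx; have ij : i < (i + j).+1 by rewrite ltnS leq_addr.
by have /= := Cx (Ordinal ij); rewrite addKn.
Qed.

Theorem theorem6p11 (G : groupType) (g : nat -> G)
    (g_enum : range g = [set: G])
    (phi : set_system G) (phi_filter : ProperFilter phi) :
  PT_filter phi <->
  forall a : G, a <> 1%g ->
    exists C : nat -> set G,
      (forall n, star_system phi (C n)) /\
      forall n f, words g n f ->
        ~ subst_word (fun i j => C (i + j)%N) f a.
Proof.
split=> [phiPT a|sep]; first exact: PT_filter_words.
have N_filter := word_filter_filter g phi_filter.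
have [|||tau tauM tau_nbhs] := @paratopology_of_filter G (word_filter g phi) N_filter.
- by move=> U [C _ CU]; apply/CU/word_nbhs1.
- move=> U [C Cphi CU]; exists (word_nbhs g (initial_cap C (fun n => n.*2.+1))).
    by exists (initial_cap C (fun n => n.*2.+1)) => // n; apply: star_initial_cap.
  by apply: subset_trans CU; apply: word_nbhsM.
- move=> h U [C Cphi CU]; have [b bC] := word_nbhsJ C h g_enum.
  exists (initial_cap C b) => [n|x /bC /CU //]; exact: star_initial_cap.
exists tau; split=> //.
- move=> x y /eqP xy.
  (* A neighbourhood of 1 missing x^-1 y, translated by x, misses y. *)
  have [|C [Cphi CP]] := sep (x^-1 * y)%g.
    by move=> xy1; apply: xy; rewrite -[y](mulVKg x) xy1 mulg1.
  have C1 n : C n 1%g by have /star_systemP[] := Cphi n.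
  have : nbhs (x : topologized tau) [set~ y : topologized tau].
    rewrite tau_nbhs; exists C => // z Cz /= zy.
    have [n [f [nf fz]]] := word_nbhs_words C1 Cz.
    by apply: CP nf _; rewrite -zy mulKg.
  rewrite nbhsE; case=> A [oA Ax Ay]; exists A; split; rewrite ?inE //.
  by move=> /Ay; apply.
- move=> A; rewrite tau_nbhs => -[C Cphi CA].
  (* When g j = 1, the one-factor product at (0, j) is [C j] itself, so [C j] lies in [A]. *)
  have [j _ gj1] : range g 1%g by rewrite g_enum.
  have /star_systemP[phiCj _] := Cphi j.
  apply: filterS phiCj => x Cx; rewrite -[x]mul1g; apply: CA.
  exists [:: (0, j)] => //=; rewrite /conj_prod big_seq1 /=.
  by exists x => //; rewrite gj1 conjg1.
Qed.
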